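(* Let $\mathbf Y$ be an $\mathrm{EMTP}_2$ Hüsler--Reiss distribution with parameter matrix $\Gamma\in\mathcal C^d$. Let $\overline\Gamma=\overline\Gamma_n$ be a consistent estimator of $\Gamma$ as the sample size $n\to\infty$ (i.e. $\overline\Gamma_n\to\Gamma$ in probability). Then the $\mathrm{EMTP}_2$ estimator $\widehat\Gamma=\widehat\Gamma_n$ based on $\overline\Gamma_n$ is consistent, that is, for any $\varepsilon>0$, $$\mathbb P\Big(\max_{i,j\in V}|\widehat\Gamma_{ij}-\Gamma_{ij}|>\varepsilon\Big)\to0,\qquad n\to\infty,$$ where $V=\{1,\dots,d\}$.
   Context: $\mathbb S^d_0$ is the space of symmetric real $d\times d$ matrices with zero diagonal, with $\langle\!\langle A,B\rangle\!\rangle=\sum_{i<j}A_{ij}B_{ij}$; $\boldsymbol 1$ is the vector of ones. $\mathcal C^d\subset\mathbb S^d_0$ is the set of $\Gamma$ with $\boldsymbol x^T\Gamma\boldsymbol x<0$ for all $\boldsymbol x\ne\boldsymbol 0$ with $\boldsymbol x^T\boldsymbol 1=0$. The Hüsler--Reiss distribution with parameter $\Gamma\in\mathcal C^d$ has precision matrix $\Theta=(\boldsymbol P(-\tfrac12\Gamma)\boldsymbol P)^+$ (Moore--Penrose inverse; $\boldsymbol P=I_d-\frac1d\boldsymbol 1\boldsymbol 1^T$), and it is $\mathrm{EMTP}_2$ if and only if $\Theta_{ij}\le0$ for all $i\ne j$ (this characterization may be taken as the meaning of $\mathrm{EMTP}_2$ here). $\mathrm{EMTP}_2$ estimator: $\overline\Gamma_n$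 are random elements of $\mathbb S^d_0$. Let $\mathbb U_+\subset\mathbb S^d_0$ be the set of entrywise nonnegative $Q$ whose support is the edge set of a connected graph on $V$, and $\ell(Q;\overline\Gamma)=\log\big(\sum_{T\in\mathcal T}\prod_{ij\in T}Q_{ij}\big)-\langle\!\langle\overline\Gamma,Q\rangle\!\rangle$, $\mathcal T$ being the set of spanning trees of the complete graph on $V$. Let $\widehat Q=\arg\max_{Q\in\mathbb U_+}\ell(Q;\overline\Gamma)$; the maximizer exists (and is unique) if and only if $\overline\Gamma_{ij}>0$ for all $i\ne j$ (on the complementary event $\widehat\Gamma$ may be defined arbitrarily). Let $\widehat\Theta$ have off-diagonal entries $-\widehat Q_{ij}$ and zero row sums, $\widehat\Sigma=\widehat\Theta^+$, and $\widehat\Gamma_{ij}=\widehat\Sigma_{ii}+\widehat\Sigma_{jj}-2\widehat\Sigma_{ij}$. Equivalently, $\widehat\Gamma$ is the unique maximizer of $\log\det\begin{bmatrix}0&-\boldsymbol 1^T\\ \boldsymbol 1&-\frac12\Gamma\end{bmatrix}$ over $\Gamma\in\mathcal C^d$ with $\Gamma\le\overline\Gamma$ entrywise. *)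

(* Defs.v *)
From HB Require Import structures.
From mathcomp Require Import all_boot all_order all_algebra.
From mathcomp Require Import all_classical all_reals all_analysis.

Set Implicit Arguments.
Unset Strict Implicit.
Unset Printing Implicit Defensive.

Import Order.TTheory GRing.Theory Num.Theory.
Import numFieldNormedType.Exports.
Local Open Scope classical_set_scope.
Local Open Scope ring_scope.

Section Matrices.
Variables (R : realType) (d : nat).
Implicit Types A G Q : 'M[R]_d.

Definition sym0 : set 'M[R]_d :=
  [set A | A^T = A /\ forall i, A i i = 0].

Definition sprod A B : R := \sum_(i < d) \sum_(j < d | (i < j)%N) A i j * B i j.

Definition ones : 'cV[R]_d := const_mx 1.

Definition cnd_cone : set 'M[R]_d :=
  [set G | sym0 G /\
    forall x : 'cV[R]_d, x != 0 -> x^T *m ones = 0 ->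
      (x^T *m G *m x) 0 0 < 0].

Definition penrose A X : Prop :=
  [/\ A *m X *m A = A, X *m A *m X = X,
      (A *m X)^T = A *m X & (X *m A)^T = X *m A].

(* The matrix [X] with [penrose A X] exists and is unique over the reals, so
   the default value 0 is never used. *)
Definition mpinv A : 'M[R]_d := xget 0 [set X | penrose A X].

Definition centering : 'M[R]_d := 1%:M - d%:R^-1 *: (ones *m ones^T).

Definition hr_precision G : 'M[R]_d :=
  mpinv (centering *m (- 2^-1 *: G) *m centering).

Definition EMTP2 G : Prop :=
  forall i j : 'I_d, i != j -> hr_precision G i j <= 0.

Definition connected_rel (e : rel 'I_d) : bool :=
  [forall i, forall j, connect e i j].

(* An undirected edge ij is encoded as the pair (i, j) with i < j. *)
Definition adj (T : {set 'I_d * 'I_d}) : rel 'I_d :=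
  fun i j => ((i, j) \in T) || ((j, i) \in T).

Definition acyclic (e : rel 'I_d) : Prop :=
  forall c : seq 'I_d, (2 < size c)%N -> ~~ ucycleb e c.

Definition spanning_tree (T : {set 'I_d * 'I_d}) : bool :=
  [&& [forall p in T, (p.1 < p.2)%N], connected_rel (adj T)
    & `[< acyclic (adj T) >]].

Definition U_plus : set 'M[R]_d :=
  [set Q | [/\ sym0 Q, forall i j, 0 <= Q i j
             & connected_rel (fun i j => Q i j != 0)]].

Definition ell Q G : R :=
  ln (\sum_(T : {set 'I_d * 'I_d} | spanning_tree T)
        \prod_(p in T) Q p.1 p.2) - sprod G Q.

Definition ell_maximizer G Q : Prop :=
  U_plus Q /\ forall Q', U_plus Q' -> ell Q' G <= ell Q G.

Definition laplacian Q : 'M[R]_d :=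
  \matrix_(i, j) if i == j then \sum_(k | k != i) Q i k else - Q i j.

Definition variogram A : 'M[R]_d :=
  \matrix_(i, j) (A i i + A j j - 2 * A i j).

(* [G'] is arbitrary when the likelihood has no maximizer. *)
Definition emtp2_estimate G G' : Prop :=
  (exists Q, ell_maximizer G Q) ->
  exists2 Q, ell_maximizer G Q & G' = variogram (mpinv (laplacian Q)).

Definition maxdist A B : R :=
  \big[Num.max/0]_(i < d) \big[Num.max/0]_(j < d) `|A i j - B i j|.

(* [mu_ext P] is the outer probability: it coincides with [P] on measurable
   events ([measurable_mu_extE]), while [P] itself has no meaning on the others,
   which can occur for estimators that are arbitrary on part of the space. *)
Definition cvg_in_prob disp (Om : measurableType disp) (P : probability Om R)
    (X : nat -> Om -> 'M[R]_d) A : Prop :=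
  forall eps : R, 0 < eps ->
    (fun n => mu_ext P [set w | eps < maxdist (X n w) A]) @ \oo --> 0%E.

Definition random_matrix disp (Om : measurableType disp)
    (X : Om -> 'M[R]_d) : Prop :=
  forall i j, measurable_fun [set: Om] (fun w => X w i j).

End Matrices.

(* Main.v *)
(* For Q in U_plus the matrix A(Q) = laplacian Q + J/d, with J the all-ones matrix,
   is positive definite, and by the matrix-tree theorem det A(Q) is d times the
   spanning-tree sum of Q.  If Q0 denotes the weights of the true precision matrix
   and T A(Q0) T^T = 1, then C(Q) = T A(Q) T^T satisfies
     ell(Q; Gamma) = ell(Q0; Gamma) - (tr C(Q) - d - ln det C(Q)),
   where the subtracted gap is nonnegative, grows linearly in tr C(Q), and is small
   only when C(Q) is close to the identity.  Replacing Gamma by a nearby Gbar changes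
   ell(Q; .) by at most a small multiple of tr C(Q); hence a maximizer exists (by
   compactness), and every maximizer Q has C(Q) close to 1.  Then the variogram of
   A(Q)^-1, which is the estimate, is close to the variogram of A(Q0)^-1, which is
   Gamma.  Convergence in probability follows from this continuity at Gamma.

   The matrix-tree theorem is proved by expanding the rows of the Laplacian grounded
   at r multilinearly over functions f with f r = r: the determinant attached to f is
   1 if every vertex is led to r by f, and 0 otherwise; and the functions leading
   every vertex to r correspond to spanning trees by orienting edges towards r. *)
From HB Require Import structures.
Require Import Defs.
From mathcomp Require Import all_boot all_order all_fingroup all_algebra.
From mathcomp Require Import all_classical all_reals all_analysis.
From mathcomp Require Import ring lra.

Set Implicit Arguments.
Unset Strict Implicit.
Unset Printing Implicit Defensive.

Import Order.TTheory GRing.Theory Num.Theory.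
Local Open Scope ring_scope.

(** * Spanning trees as functions leading to a root *)

Section RootedFunctions.
Variables (d : nat) (r : 'I_d).
Implicit Types (f g : {ffun 'I_d -> 'I_d}) (i j : 'I_d).

Definition oedge i j : 'I_d * 'I_d := if (i < j)%N then (i, j) else (j, i).

(** A rooted tree is stored as its parent map, in which the root is its own parent. *)
Definition rooted f : bool := (f r == r) && [forall i, fconnect f i r].

Definition rooted_edges f : {set 'I_d * 'I_d} :=
  [set oedge i (f i) | i in predC1 r].

(** The height of [i] is the least number of iterations of [f] leading from [i] to [r]; later
    arguments about rooted maps descend along it. *)
Lemma rooted_height f : rooted f ->
  exists h : 'I_d -> nat, forall i, i != r -> (h (f i) < h i)%N.
Proof.
case/andP=> _ /forallP conn.
have reach i : exists k, iter k f i == r.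
  by exists (findex f i r); rewrite iter_findex.
exists (fun i => ex_minn (reach i)) => i ir.
case: (ex_minnP (reach i)) => -[|k]; first by rewrite /= (negbTE ir).
rewrite iterSr => ki _; case: ex_minnP => m _ /(_ _ ki).
by rewrite ltnS.
Qed.

Lemma height_rooted f (h : 'I_d -> nat) : f r = r ->
  (forall i, i != r -> (h (f i) < h i)%N) -> rooted f.
Proof.
move=> fr hf; rewrite /rooted fr eqxx /=; apply/forallP => i.
have [k] := ubnP (h i); elim: k i => // k IH i; rewrite ltnS => hk.
have [->|ir] := eqVneq i r; first exact: connect0.
apply: connect_trans (fconnect1 f i) _; apply: IH.
exact: leq_trans (hf _ ir) hk.
Qed.

Lemma rooted_neq f i : rooted f -> i != r -> f i != i.
Proof.
move=> /rooted_height[h hf] /hf; apply: contraTneq => ->.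
by rewrite ltnn.
Qed.

Lemma oedge_eqP i j k l : oedge i j = oedge k l ->
  (i = k /\ j = l) \/ (i = l /\ j = k).
Proof. by rewrite /oedge; do 2 case: ifP => _; case; auto. Qed.

Lemma adj_rooted_edges f i j : adj (rooted_edges f) i j =
  ((i != r) && (f i == j)) || ((j != r) && (f j == i)).
Proof.
have oedgeC k l : k != r -> f k = l -> adj (rooted_edges f) k l.
  move=> kr <-; rewrite /adj.
  have: oedge k (f k) \in rooted_edges f by apply: imset_f.
  by rewrite {1}/oedge; case: ifP => _ ->; rewrite ?orbT.
apply/idP/idP; last first.
  case/orP => /andP[kr /eqP fk]; first exact: oedgeC.
  by rewrite /adj orbC; apply: oedgeC.
rewrite /adj => /orP[] /imsetP[k kr]; rewrite /oedge; case: ifP => _ [-> ->];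
  by move: kr; rewrite !inE => ->; rewrite eqxx ?orbT.
Qed.

Lemma adjC (T : {set 'I_d * 'I_d}) : symmetric (adj T).
Proof. by move=> i j; rewrite /adj orbC. Qed.

Lemma rooted_connected f (e : rel 'I_d) : rooted f -> symmetric e ->
  (forall i, i != r -> e i (f i)) -> connected_rel e.
Proof.
move=> /rooted_height[h hf] es ef.
have conn i : connect e i r.
  have [k] := ubnP (h i); elim: k i => // k IH i; rewrite ltnS => hk.
  have [->|ir] := eqVneq i r; first exact: connect0.
  apply: connect_trans (connect1 (ef _ ir)) _; apply: IH.
  exact: leq_trans (hf _ ir) hk.
apply/forallP => i; apply/forallP => j; apply: connect_trans (conn i) _.
by rewrite (sym_connect_sym es) conn.
Qed.

(* On a cycle, both neighbours of a vertex of maximal height would be its image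
   under f. *)
Lemma rooted_acyclic f : rooted f -> acyclic (adj (rooted_edges f)).
Proof.
move=> /rooted_height[h hf] c csz; apply/negP => /andP[cyc uc].
have [x0 x0c] : exists x0, x0 \in c.
  by case: c csz {cyc uc} => // x c; exists x; rewrite mem_head.
case: (@arg_maxnP _ x0 (mem c) h x0c) => x xc hx.
have up y : y \in c -> adj (rooted_edges f) x y -> y = f x.
  move=> yc; rewrite adj_rooted_edges => /orP[/andP[_ /eqP]//|/andP[yr /eqP fy]].
  by have := hx _ yc; rewrite /= -fy leqNgt => /negP[]; apply: hf.
have E : next c x = prev c x.
  transitivity (f x); [apply: up|apply/esym; apply: up].
  - by rewrite mem_next.
  - exact: next_cycle cyc xc.
  - by rewrite mem_prev.
  - by rewrite adjC; apply: prev_cycle cyc xc.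
(* With [c] rotated to start at [x], the successor of [x] is the second vertex and its predecessor
   the last one; they differ because [c] has at least three distinct vertices. *)
have [i p ep] := rot_to xc.
have: next (rot i c) x = prev (rot i c) x by rewrite next_rot // prev_rot.
have : uniq (rot i c) by rewrite rot_uniq.
have : (2 < size (rot i c))%N by rewrite size_rot.
rewrite ep; case: p {ep} => [//|y [//|z p]] _ /andP[xp yp].
have -> : next (x :: y :: z :: p) x = y by rewrite next_nth mem_head /= eqxx.
have -> : prev (x :: y :: z :: p) x = last z p.
  rewrite prev_nth mem_head (memNindex xp).
  exact: (nth_last x (x :: y :: z :: p)).
by move=> yE; move: yp; rewrite yE mem_last.
Qed.

Lemma rooted_spanning_tree f : rooted f -> spanning_tree (rooted_edges f).
Proof.
move=> rf; apply/and3P; split.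
- apply/forall_inP => p /imsetP[i]; rewrite inE => ir ->; rewrite /oedge.
  by have := rooted_neq rf ir; rewrite -val_eqE /=; case: (ltngtP (f i) i).
- apply: (rooted_connected rf); first exact: adjC.
  by move=> i ir; rewrite adj_rooted_edges ir eqxx.
- by apply/asboolP; apply: rooted_acyclic.
Qed.

(* f i is a neighbour of i that is closer to r. *)
Lemma connected_rooted (e : rel 'I_d) : connected_rel e ->
  exists2 f, rooted f & forall i, i != r -> e i (f i).
Proof.
move=> /forallP conn.
(* Walks of exactly [k] edges to [r] are considered, so that [h] below is the graph distance to
   [r]. *)
pose reach i k := [exists p : k.-tuple 'I_d, path e i p && (last i p == r)].
have ex i : exists k, reach i k.
  have /connectP[p ep lp] := forallP (conn i) r.
  by exists (size p); apply/existsP; exists (in_tuple p); rewrite /= ep -lp eqxx.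
pose h i := ex_minn (ex i).
have nxt i : i != r -> exists2 j, e i j & (h j < h i)%N.
  rewrite {2}/h; case: ex_minnP => k /existsP[[p /= /eqP sp]] /andP[ep lp] _ ir.
  case: p sp ep lp => [|j p] /= sp; first by rewrite (negbTE ir).
  case/andP=> eij ep lp; exists j => //; rewrite /h; case: ex_minnP => m _.
  rewrite -sp ltnS; apply; apply/existsP; exists (in_tuple p).
  by rewrite /= ep.
pose f := [ffun i => if i == r then r else
  odflt r [pick j | e i j && (h j < h i)%N]].
have fP i : i != r -> e i (f i) && (h (f i) < h i)%N.
  move=> ir; rewrite ffunE (negbTE ir); case: pickP => //= none.
  by have [j eij hj] := nxt _ ir; have := none j; rewrite eij hj.
exists f => [|i /fP/andP[]//].
apply: (@height_rooted f h); first by rewrite ffunE eqxx.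
by move=> i /fP/andP[].
Qed.

(** Connectedness yields an [f] all of whose edges lie in [T]. A further edge of [T] would close a
    cycle with the path of [rooted_edges f] joining its ends. *)
Lemma spanning_tree_rooted (T : {set 'I_d * 'I_d}) : spanning_tree T ->
  exists2 f, rooted f & rooted_edges f = T.
Proof.
case/and3P=> /forall_inP Tlt conn /asboolP acy.
have [f rf fT] := connected_rooted conn; exists f => //.
have sub i j : adj (rooted_edges f) i j -> adj T i j.
  rewrite adj_rooted_edges => /orP[] /andP[kr /eqP <-]; first exact: fT.
  by rewrite adjC fT.
apply/setP => -[i j]; apply/idP/idP => [/imsetP[k]|ijT].
  rewrite inE => /fT; rewrite /adj /oedge.
  case: ifP => [lt|/negbT le] /orP[] kT [-> ->] //; have := Tlt _ kT => /=.
    by rewrite ltnNge (ltnW lt).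
  by rewrite (negbTE le).
have ij := Tlt _ ijT; rewrite /= in ij.
have [//|ijN] := boolP ((i, j) \in rooted_edges f).
have ijA : adj (rooted_edges f) i j = false.
  rewrite /adj (negbTE ijN) /=; apply/negP => /imsetP[k kr]; rewrite /oedge.
  by case: ifP => lt [E1 E2]; move: ij; rewrite E1 E2 ?lt // ltnNge ltnW.
have/and3P[_ /forallP/(_ i)/forallP/(_ j) + _] := rooted_spanning_tree rf.
case/connectP => p0 /shortenP[p ep up _ {p0} E].
(* The path has at least two edges: its ends are distinct and not adjacent in [rooted_edges f]. *)
have : (2 < size (i :: p))%N.
  case: p ep E {up} => [|k [|//]] /=; first by move=> _ E; rewrite E ltnn in ij.
  by rewrite andbT => + E; rewrite -E ijA.
move=> /acy/negP[]; rewrite /ucycleb up andbT /= rcons_path -E.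
rewrite (sub_path sub ep) /adj ijT orbT //.
Qed.

(** If [f] and [g] differ at [i], then [f] uses the edge from [i] to [g i] backwards, so they also
    differ at [g i]; this would descend forever in the height of [g]. *)
Lemma rooted_edges_inj f g : rooted f -> rooted g ->
  rooted_edges f = rooted_edges g -> f = g.
Proof.
move=> rf rg E; apply/ffunP => i.
have [h hg] := rooted_height rg.
have step i0 : i0 != r -> g i0 != f i0 -> g i0 != r /\ f (g i0) = i0.
  move=> ir; have : adj (rooted_edges f) i0 (g i0).
    by rewrite E adj_rooted_edges ir eqxx.
  rewrite adj_rooted_edges ir /= eq_sym => /orP[->//|/andP[? /eqP]] //.
have [->|ir] := eqVneq i r.
  by case/andP: rf => /eqP-> _; case/andP: rg => /eqP-> _.
apply/eqP; rewrite eq_sym; apply: contraT.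
have [k] := ubnP (h i); elim: k i ir => // k IH i ir; rewrite ltnS => hk gf.
have [gr fg] := step _ ir gf; apply: (IH (g i)) => //.
  exact: leq_trans (hg _ ir) hk.
rewrite fg; apply/eqP => gg; have := hg _ gr; rewrite gg.
by apply/negP; rewrite -leqNgt ltnW // hg.
Qed.

(** Each spanning tree has exactly one preimage under [rooted_edges], and the symmetry of [Q] makes
    the orientation irrelevant. *)
Lemma sum_spanning_tree (A : comNzRingType) (Q : 'I_d -> 'I_d -> A) :
  (forall i j, Q i j = Q j i) ->
  \sum_(T : {set 'I_d * 'I_d} | spanning_tree T) \prod_(p in T) Q p.1 p.2 =
  \sum_(f | rooted f) \prod_(i | i != r) Q i (f i).
Proof.
move=> Qs; rewrite [RHS](partition_big rooted_edges (@spanning_tree d)) /=; last first.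
  by move=> f /rooted_spanning_tree.
apply: eq_bigr => T /spanning_tree_rooted[f rf <-].
rewrite (big_pred1 f) => [|g]; last first.
  apply/andP/eqP => [[rg /eqP]|->//]; exact: rooted_edges_inj.
(* Two vertices giving the same edge would be exchanged by [f], against the height. *)
rewrite big_imset => [|i j]; last first.
  rewrite !inE => ir jr /oedge_eqP[[]//|[ifj fij]].
  have [h hf] := rooted_height rf.
  have := hf _ jr; rewrite -ifj => /(ltn_trans (hf _ ir)).
  by rewrite fij ltnn.
apply: eq_big => [i|i _]; first by rewrite inE.
by rewrite /oedge; case: ifP.
Qed.

End RootedFunctions.

(** * The matrix-tree theorem *)

Section MatrixTree.
Variables (F : fieldType) (d : nat) (r : 'I_d).
Implicit Types (f : {ffun 'I_d -> 'I_d}) (i j k : 'I_d).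

(** Multilinearity in the rows: [f] records which term is picked in each row. *)
Lemma det_sum_rows (W : 'I_d -> 'I_d -> F) (B : 'I_d -> 'I_d -> 'I_d -> F) :
  \det (\matrix_(i, k) \sum_j W i j * B i j k) =
  \sum_(f : {ffun 'I_d -> 'I_d})
    (\prod_i W i (f i)) * \det (\matrix_(i, k) B i (f i) k).
Proof.
under eq_bigr do rewrite big_distrr /=.
rewrite exchange_big /=; apply: eq_bigr => s _.
under eq_bigr do rewrite mxE.
rewrite bigA_distr_bigA big_distrr /=; apply: eq_bigr => f _.
rewrite big_split /= mulrCA; congr (_ * (_ * _)).
by apply: eq_bigr => i _; rewrite mxE.
Qed.

(** The Laplacian of the directed graph with an edge from each [i] other than [r] to [f i], with a
    unit row at [r]. *)
Definition function_mx f : 'M[F]_d :=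
  \matrix_(i, k) ((i == k)%:R - ((i != r) && (f i == k))%:R).

(* A permutation contributing to the determinant moves every index to one of at
   most the same height, so it fixes all of them. *)
Lemma det_function_mx_rooted f : rooted r f -> \det (function_mx f) = 1.
Proof.
move=> rf; have [h hf] := rooted_height rf.
rewrite /determinant (bigD1 (1%g : 'S_d)) //= odd_perm1 expr0 mul1r.
rewrite big1 => [|i _]; last first.
  rewrite mxE perm1 eqxx; case: eqP => [->|/eqP ir]; rewrite ?subr0 //=.
  by rewrite (negbTE (rooted_neq rf ir)) subr0.
rewrite big1 ?addr0 // => s s1; apply/eqP; rewrite mulf_eq0 signr_eq0 /=.
apply: contraT => /prodf_neq0 nz.
have hs i : (h (s i) <= h i)%N /\ ((h (s i) == h i) = (s i == i)).
  have := nz i isT; rewrite mxE; have [<-|si] := eqVneq i (s i).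
    by rewrite !eqxx leqnn.
  rewrite sub0r oppr_eq0; have [->|ir] := eqVneq i r; first by rewrite eqxx.
  have [<- _|] := eqVneq (f i) (s i); last by rewrite eqxx.
  have lt := hf _ ir; rewrite ltnW // ltn_eqF // eq_sym.
(* Both sides have the same sum over [i], as [s] permutes the indices, so every inequality is an
   equality. *)
have /leqif_sum E : forall i, true -> (h (s i) <= h i ?= iff (s i == i))%N.
  by move=> i _; have [] := hs i.
have := E.2; rewrite [in X in _ == X](reindex_inj (@perm_inj _ s)) /=.
rewrite eqxx => /esym/forallP fix_s; case/eqP: s1; apply/permP => i.
by rewrite perm1; apply/eqP/fix_s.
Qed.

(* The indicator of the vertices that never reach r is in the kernel. *)
Lemma det_function_mx_unrooted f : f r = r -> ~~ rooted r f ->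
  \det (function_mx f) = 0.
Proof.
move=> fr; rewrite /rooted fr eqxx /= negb_forall => /existsP[i0 i0r].
apply/eqP; rewrite -det_tr; apply/det0P.
exists (\row_i (~~ fconnect f i r)%:R).
  by apply/eqP => /rowP/(_ i0)/eqP; rewrite !mxE i0r oner_eq0.
apply/rowP => i; rewrite !mxE.
under eq_bigr do rewrite !mxE mulrBr.
rewrite big_split /= (bigD1 i) //= eqxx mulr1 big1 ?addr0; last first.
  by move=> j ji; rewrite eq_sym (negbTE ji) mulr0.
have [->|ir] := eqVneq i r.
  by rewrite connect0 add0r big1 // => j _; rewrite mulr0 oppr0.
rewrite (bigD1 (f i)) //= eqxx mulr1 big1 ?addr0; last first.
  by move=> j ji; rewrite eq_sym (negbTE ji) mulr0 oppr0.
suff -> : fconnect f i r = fconnect f (f i) r by rewrite subrr.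
apply/idP/idP => [/iter_findex|]; last first.
  exact: connect_trans (fconnect1 f i).
case: (findex f i r) => [/= E|k]; first by rewrite E eqxx in ir.
by rewrite iterSr => <-; apply: fconnect_iter.
Qed.

(** A row [i] other than [r] is the sum, with weights [Q i j], of the differences of the unit rows
    at [i] and [j]. *)
Lemma det_grounded_laplacian (Q : 'M[F]_d) :
  (forall i, Q i i = 0) ->
  \det (\matrix_(i, k) if i == r then (i == k)%:R else
          (i == k)%:R * (\sum_j Q i j) - Q i k) =
  \sum_(f | rooted r f) \prod_(i | i != r) Q i (f i).
Proof.
move=> Q0.
(* The row of [r] has the single term [j = r], which forces [f r = r]. *)
pose W i j := if i == r then (j == r)%:R else Q i j.
pose B i j k : F := (i == k)%:R - ((i != r) && (j == k))%:R.
transitivity (\det (\matrix_(i, k) \sum_j W i j * B i j k)).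
  congr (\det _); apply/matrixP => i k; rewrite !mxE /W /B.
  case: eqP => [->|_] /=.
    rewrite (bigD1 r) //= eqxx mul1r subr0 big1 ?addr0 // => j /negbTE ->.
    by rewrite mul0r.
  under [RHS]eq_bigr do rewrite mulrBr.
  rewrite big_split /= -mulr_suml mulrC; congr (_ + _).
  rewrite (bigD1 k) //= eqxx mulr1 big1 ?addr0 // => j /negbTE ->.
  by rewrite mulr0 oppr0.
rewrite det_sum_rows [RHS]big_mkcond /=; apply: eq_bigr => f _.
rewrite -/(function_mx f) (bigD1 r) //= {1}/W eqxx.
have [fr|fr] := eqVneq (f r) r; last first.
  by rewrite !mul0r /rooted (negbTE fr).
rewrite mul1r; case: ifPn => rf.
  rewrite det_function_mx_rooted // mulr1; apply: eq_bigr => i /negbTE ir.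
  by rewrite /W ir.
by rewrite det_function_mx_unrooted ?mulr0.
Qed.

(* [[1, -v], [u, 1]] is block-triangularized in two ways. *)
Lemma det_1_add_dyad n (u : 'cV[F]_n) (v : 'rV[F]_n) :
  \det (1%:M + u *m v) = 1 + (v *m u) 0 0.
Proof.
pose X : 'M[F]_(1 + n) := block_mx 1%:M (- v) u 1%:M.
have E1 : block_mx 1%:M 0 (- u) 1%:M *m X = block_mx 1%:M (- v) 0 (1%:M + u *m v).
  by rewrite mulmx_block !mul1mx !mul0mx mulmx1 mulNmx mulmxN !addr0 opprK addNr addrC.
have E2 : block_mx 1%:M v 0 1%:M *m X = block_mx (1%:M + v *m u) 0 u 1%:M.
  by rewrite mulmx_block !mul1mx !mul0mx mulmx1 !add0r addNr.
have := congr1 determinant E1; have := congr1 determinant E2.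
rewrite !det_mulmx !det_lblock !det_ublock !det1 !mul1r !mulr1 => -> <-.
by rewrite det_mx11 !mxE eqxx.
Qed.

End MatrixTree.

(** * Positive definite matrices and the log-determinant *)

Section PositiveDefinite.
Variable R : realType.

Definition posdef n (A : 'M[R]_n) : Prop :=
  A^T = A /\ forall x : 'cV[R]_n, x != 0 -> 0 < (x^T *m A *m x) 0 0.

Lemma posdef_unit n (A : 'M[R]_n) : posdef A -> A \in unitmx.
Proof.
case=> _ Apos; rewrite unitmxE unitfE; apply/negP => /det0P[v v0 vA].
have := Apos v^T; rewrite trmx_eq0 trmxK vA mul0mx mxE ltxx.
by move/(_ v0).
Qed.

Lemma posdef_congr n (A X : 'M[R]_n) : posdef A -> X \in unitmx ->
  posdef (X *m A *m X^T).
Proof.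
case=> As Apos Xu; split=> [|x x0]; first by rewrite !trmx_mul trmxK As mulmxA.
have := Apos (X^T *m x); rewrite trmx_mul trmxK !mulmxA; apply.
apply: contraNneq x0 => X0; rewrite -(mul1mx x) -trmx1 -(mulmxV Xu) trmx_mul.
by rewrite -mulmxA X0 mulmx0.
Qed.

Lemma posdef_invmx n (A : 'M[R]_n) : posdef A -> posdef (invmx A).
Proof.
move=> Apd; have Au := posdef_unit Apd.
have -> : invmx A = invmx A *m A *m (invmx A)^T.
  by rewrite mulVmx // mul1mx trmx_inv Apd.1.
by apply: posdef_congr; rewrite ?unitmx_inv.
Qed.

(** * Schur complements and congruence to the identity *)

Definition schur n (A : 'M[R]_(1 + n)) : 'M[R]_n :=
  drsubmx A - (A 0 0)^-1 *: (dlsubmx A *m (dlsubmx A)^T).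

Definition schur_elim n (A : 'M[R]_(1 + n)) : 'M[R]_(1 + n) :=
  block_mx 1%:M 0 (- (A 0 0)^-1 *: dlsubmx A) 1%:M.

Lemma det_schur_elim n (A : 'M[R]_(1 + n)) : \det (schur_elim A) = 1.
Proof. by rewrite det_lblock !det1 mulr1. Qed.

Lemma posdef_diag n (A : 'M[R]_n) i : posdef A -> 0 < A i i.
Proof.
case=> _ /(_ (delta_mx i 0)); rewrite trmx_delta -rowE -colE !mxE; apply.
by apply/eqP => /matrixP/(_ i 0)/eqP; rewrite !mxE !eqxx oner_eq0.
Qed.

Lemma schur_elimE n (A : 'M[R]_(1 + n)) : A^T = A -> A 0 0 != 0 ->
  schur_elim A *m A *m (schur_elim A)^T = block_mx (A 0 0)%:M 0 0 (schur A).
Proof.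
move=> As a0.
have ulE : ulsubmx A = (A 0 0)%:M.
  by rewrite [LHS]mx11_scalar; congr (_%:M); rewrite !mxE; congr (A _ _); apply: val_inj.
have urE : ursubmx A = (dlsubmx A)^T by rewrite trmx_dlsub As.
rewrite -[X in _ *m X *m _]submxK ulE urE /schur_elim tr_block_mx !trmx1 trmx0.
rewrite !mulmx_block !mul1mx !mul0mx !mulmx1 !mulmx0 !addr0.
have -> : - (A 0 0)^-1 *: dlsubmx A *m (A 0 0)%:M + dlsubmx A = 0.
  by rewrite mul_mx_scalar scaleNr scalerN scalerA divff // scale1r addNr.
rewrite mul0mx add0r mul_scalar_mx linearZ /= scaleNr scalerN scalerA divff //.
by rewrite scale1r addNr scaleNr mulNmx -scalemxAl addrC.
Qed.

Lemma posdef_schur n (A : 'M[R]_(1 + n)) : posdef A -> posdef (schur A).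
Proof.
move=> Apd; have a0 := posdef_diag 0 Apd.
have: posdef (block_mx ((A 0 0)%:M : 'M[R]_1) 0 0 (schur A)).
  rewrite -schur_elimE ?gt_eqF //; last by case: Apd.
  by apply: posdef_congr; rewrite // unitmxE det_schur_elim unitr1.
case; rewrite tr_block_mx => /eq_block_mx[_ _ _ Ss] pos; split=> // x x0.
have := pos (col_mx 0 x); rewrite col_mx_eq0 (negbTE x0) andbF => /(_ isT).
by rewrite tr_col_mx trmx0 mul_row_block mul_row_col !mul0mx !mulmx0 !add0r.
Qed.

Lemma det_schur n (A : 'M[R]_(1 + n)) : posdef A ->
  \det A = A 0 0 * \det (schur A).
Proof.
move=> Apd; have a0 := posdef_diag 0 Apd.
have := congr1 determinant (schur_elimE Apd.1 (lt0r_neq0 a0)).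
by rewrite !det_mulmx det_tr det_schur_elim mul1r mulr1 det_ublock det_scalar1.
Qed.

Lemma posdef_det_gt0 n (A : 'M[R]_n) : posdef A -> 0 < \det A.
Proof.
elim: n A => [|n IH] A Apd; first by rewrite det_mx00.
by rewrite (@det_schur n) // mulr_gt0 ?IH ?(posdef_diag 0 Apd) //; apply: posdef_schur.
Qed.

(** Cholesky reduction: eliminate the first column, rescale the pivot to 1 and continue with the
    Schur complement. *)
Lemma posdef_diagonalize n (A : 'M[R]_n) : posdef A ->
  exists2 T, T \in unitmx & T *m A *m T^T = 1%:M.
Proof.
elim: n A => [|n IH].
  by move=> A _; exists 1%:M; rewrite ?unitmx1 //; apply/matrixP => -[].
rewrite -[n.+1]/(1 + n)%N => A Apd.
have [T Tu TE] := IH _ (posdef_schur Apd).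
have a0 := posdef_diag 0 Apd.
pose s := (Num.sqrt (A 0 0))^-1.
have s0 : s != 0 by rewrite invr_eq0 sqrtr_eq0 -ltNge.
pose D := block_mx (@scalar_mx R 1 s) 0 0 T.
exists (D *m schur_elim A).
  rewrite unitmx_mul 2!unitmxE det_schur_elim unitr1 andbT.
  by rewrite /D det_ublock det_scalar1 unitrM unitfE s0 -unitmxE.
rewrite trmx_mul !mulmxA -(mulmxA D) -(mulmxA D).
rewrite schur_elimE ?gt_eqF //; last by case: Apd.
rewrite /D tr_block_mx !mulmx_block !trmx0 tr_scalar_mx.
rewrite !mulmx0 !mul0mx !addr0 !add0r TE -!scalar_mxM.
have -> : s * A 0 0 * s = 1; last first.
  by rewrite !mul0mx -scalar_mx_block.
by rewrite mulrAC -invfM -expr2 sqr_sqrtr ?ltW // mulVf ?gt_eqF.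
Qed.

(* Up to an additive constant, ell at Q is minus this function of a matrix
   congruent to the Laplacian of Q; it is the sum of [x - 1 - ln x] over the
   eigenvalues x. *)
Definition logdet_gap n (A : 'M[R]_n) : R := \tr A - n%:R - ln (\det A).

Lemma mxtrace_schur n (A : 'M[R]_(1 + n)) :
  \tr A = A 0 0 + (A 0 0)^-1 * (\sum_i dlsubmx A i 0 ^+ 2) + \tr (schur A).
Proof.
rewrite -[X in \tr X]submxK mxtrace_block /schur raddfB /= mxtraceZ.
have -> : \tr (dlsubmx A *m (dlsubmx A)^T) = \sum_i dlsubmx A i 0 ^+ 2.
  by apply: eq_bigr => i _; rewrite mxE big_ord1 [(dlsubmx A)^T _ _]mxE expr2.
have -> : \tr (ulsubmx A) = A 0 0.
  by rewrite /mxtrace big_ord1 !mxE; congr (A _ _); apply: val_inj.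
ring.
Qed.

(** Pivots take the place of eigenvalues: the gap becomes a sum of nonnegative terms, which the
    inductions below bound separately. *)
Lemma logdet_gap_schur n (A : 'M[R]_(1 + n)) : posdef A ->
  logdet_gap A = (A 0 0 - 1 - ln (A 0 0)) +
    (A 0 0)^-1 * (\sum_i dlsubmx A i 0 ^+ 2) + logdet_gap (schur A).
Proof.
move=> Apd; have a0 := posdef_diag 0 Apd.
have S0 := posdef_det_gt0 (posdef_schur Apd).
by rewrite /logdet_gap det_schur // lnM // mxtrace_schur natrD; ring.
Qed.

(** With [s] the square root of [x], [ln x = 2 ln s <= 2 (s - 1)], and [s ^+ 2 - 1 - 2 (s - 1)] is
    the square on the left. *)
Lemma ln_gap_ge (x : R) : 0 < x -> (Num.sqrt x - 1) ^+ 2 <= x - 1 - ln x.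
Proof.
move=> x0; have s0 : 0 < Num.sqrt x by rewrite sqrtr_gt0.
have := le_ln1Dx (x := Num.sqrt x - 1); rewrite [1 + _]addrC subrK => Hl.
have {}Hl := Hl ltac:(lra).
have xE : x = Num.sqrt x ^+ 2 by rewrite sqr_sqrtr ?ltW.
have -> : ln x = ln (Num.sqrt x) *+ 2 by rewrite {1}xE lnXn.
rewrite [X in _ <= X - _ - _]xE; nra.
Qed.

Lemma logdet_gap_ge0 n (A : 'M[R]_n) : posdef A -> 0 <= logdet_gap A.
Proof.
elim: n A => [|n IH].
  by move=> A _; rewrite /logdet_gap det_mx00 ln1 /mxtrace big_ord0 !subr0.
rewrite -[n.+1]/(1 + n)%N => A Apd; rewrite logdet_gap_schur //.
have a0 := posdef_diag 0 Apd.
apply: addr_ge0; last exact/IH/posdef_schur.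
apply: addr_ge0.
  exact: le_trans (sqr_ge0 _) (ln_gap_ge a0).
by rewrite mulr_ge0 ?invr_ge0 ?(ltW a0) // sumr_ge0 // => i _; apply: sqr_ge0.
Qed.

Lemma logdet_gap_ge_trace n (A : 'M[R]_n) : posdef A ->
  \tr A / 2 - n%:R <= logdet_gap A.
Proof.
elim: n A => [|n IH].
  by move=> A _; rewrite /logdet_gap det_mx00 ln1 /mxtrace big_ord0 !subr0 mul0r.
rewrite -[n.+1]/(1 + n)%N => A Apd; have a0 := posdef_diag 0 Apd.
have := IH _ (posdef_schur Apd); rewrite logdet_gap_schur //.
rewrite mxtrace_schur.
have s0 : 0 <= Num.sqrt (A 0 0) by rewrite sqrtr_ge0.
have sE : A 0 0 = Num.sqrt (A 0 0) ^+ 2 by rewrite sqr_sqrtr ?ltW.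
have := ln_gap_ge a0; rewrite natrD.
have : 0 <= (A 0 0)^-1 * (\sum_i dlsubmx A i 0 ^+ 2).
  by rewrite mulr_ge0 ?invr_ge0 ?(ltW a0) // sumr_ge0 // => i _; apply: sqr_ge0.
move: (_^-1 * _) (\tr _) (logdet_gap _) => q t g q0 lg IHg.
(* For a pivot [s ^+ 2], the bound [(s - 1) ^+ 2 >= s ^+ 2 / 2 - 1] amounts to
   [(s - 2) ^+ 2 >= 0]. *)
have := sqr_ge0 (Num.sqrt (A 0 0) - 2); nra.
Qed.

(** As all terms of [logdet_gap_schur] are nonnegative, a small gap makes the pivot close to 1, the
    first column small and, by induction, the Schur complement close to the identity. *)
Lemma logdet_gap_near n (eps : R) : 0 < eps -> exists2 eta, 0 < eta &
  forall A : 'M[R]_n, posdef A -> logdet_gap A <= eta ->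
  forall i j, `|A i j - (i == j)%:R| <= eps.
Proof.
elim: n eps => [|n IH] eps eps0; first by exists 1 => // A _ _ [].
(* Capping the tolerance at 1 allows [e ^+ 2] to be bounded by [e]. *)
pose e := Num.min eps 1.
have e0 : 0 < e by rewrite lt_min eps0 ltr01.
have e1 : e <= 1 by rewrite ge_min lexx orbT.
have e_eps : e <= eps by rewrite ge_min lexx.
have [eta0 eta00 IHn] := IH (e / 4) ltac:(lra).
exists (Num.min eta0 ((e / 16) ^+ 2)).
  by rewrite lt_min eta00 exprn_gt0 //; lra.
rewrite -[n.+1]/(1 + n)%N => A Apd; rewrite le_min => /andP[].
have a0 := posdef_diag 0 Apd; have Spd := posdef_schur Apd.
have S0 := logdet_gap_ge0 Spd.
rewrite logdet_gap_schur //.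
set q := (X in _ + X + _); set p := A 0 0 - 1 - _.
have q0 : 0 <= q.
  by rewrite mulr_ge0 ?invr_ge0 ?(ltW a0) // sumr_ge0 // => i _; apply: sqr_ge0.
have p0 := le_trans (sqr_ge0 _) (ln_gap_ge a0); rewrite -/p in p0.
move=> h1 h2.
have gS : logdet_gap (schur A) <= eta0 by lra.
have hp : (Num.sqrt (A 0 0) - 1) ^+ 2 <= (e / 16) ^+ 2.
  by apply: le_trans (ln_gap_ge a0) _; rewrite -/p; lra.
have hq : q <= (e / 16) ^+ 2 by lra.
have {}hp : `|Num.sqrt (A 0 0) - 1| <= e / 16.
  by rewrite -ler_sqr ?nnegrE ?normr_ge0 ?real_normK ?num_real //; lra.
have s0 : 0 <= Num.sqrt (A 0 0) by rewrite sqrtr_ge0.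
have sE : A 0 0 = Num.sqrt (A 0 0) ^+ 2 by rewrite sqr_sqrtr ?ltW.
move: hp; rewrite ler_norml => /andP[hp1 hp2].
have ha : `|A 0 0 - 1| <= e by rewrite ler_norml; apply/andP; split; rewrite sE; nra.
have a2 : A 0 0 <= 2 by move: ha; rewrite ler_norml => /andP[]; lra.
have vi i : dlsubmx A i 0 ^+ 2 <= A 0 0 * q.
  rewrite mulrA divff ?gt_eqF // mul1r (bigD1 i) //= lerDl sumr_ge0 // => j _.
  exact: sqr_ge0.
have vle i : `|dlsubmx A i 0| <= e.
  rewrite -ler_sqr ?nnegrE ?normr_ge0 ?real_normK ?num_real ?(ltW e0) //.
  apply: le_trans (vi i) _; nra.
have As : forall i j, A i j = A j i by move=> i j; rewrite -[in RHS]Apd.1 mxE.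
move=> i j; apply: (le_trans _ e_eps).
case: (split_ordP i) => i' ->; case: (split_ordP j) => j' ->.
- by rewrite !ord1 eqxx; move: ha; congr (`|A _ _ - _| <= _); apply: val_inj.
- by rewrite As eq_lrshift subr0; have := vle j'; rewrite !mxE (ord1 i').
- by rewrite eq_rlshift subr0; have := vle i'; rewrite !mxE (ord1 j').
rewrite eq_rshift.
have := IHn _ Spd gS i' j'; rewrite !mxE big_ord1 [(dlsubmx A)^T _ _]mxE.
(* The remaining block is the Schur complement plus this dyad, whose entries are controlled by
   [|u v| <= (u ^+ 2 + v ^+ 2) / 2]. *)
have : `|(A 0 0)^-1 * (dlsubmx A i' 0 * dlsubmx A j' 0)| <= q.
  rewrite normrM gtr0_norm ?invr_gt0 // ler_pM2l ?invr_gt0 //.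
  have vs k : dlsubmx A k 0 ^+ 2 <= \sum_k dlsubmx A k 0 ^+ 2.
    by rewrite [X in _ <= X](bigD1 k) //= lerDl sumr_ge0 // => l _; apply: sqr_ge0.
  have := vs i'; have := vs j'; rewrite ler_norml.
  by move=> *; apply/andP; split; nra.
rewrite !ler_norml => /andP[h3 h4] /andP[h5 h6]; apply/andP.
by split; nra.
Qed.

(** From [B = 1 - (C - 1) B] for the inverse [B], the entries of [B - 1] are at most [n delta m],
    where [m] is the largest absolute entry of [B]; since [n delta <= 1/2], this gives [m <= 2]. *)
Lemma invmx_near n (eps : R) : 0 < eps -> exists2 delta, 0 < delta &
  forall C : 'M[R]_n, C \in unitmx ->
  (forall i j, `|C i j - (i == j)%:R| <= delta) ->
  forall i j, `|invmx C i j - (i == j)%:R| <= eps.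
Proof.
move=> eps0; pose e := Num.min eps 1.
have e0 : 0 < e by rewrite lt_min eps0 ltr01.
have e1 : e <= 1 by rewrite ge_min lexx orbT.
have e_eps : e <= eps by rewrite ge_min lexx.
(* The factor 2 absorbs the bound [m <= 2], and [n.+1] keeps the denominator nonzero when [n] is
   0. *)
have n0 : 0 < 2 * n.+1%:R :> R by rewrite mulr_gt0.
exists (e / (2 * n.+1%:R)); first by rewrite divr_gt0.
move=> C Cu hC i j; set B := invmx C; set delta := e / _ in hC.
have nd : n%:R * delta <= e / 2.
  rewrite /delta mulrA ler_pdivrMr //.
  have -> : e / 2 * (2 * n.+1%:R) = e * n.+1%:R by field.
  by rewrite mulrC ler_wpM2l ?(ltW e0) // ler_nat.
case: (@arg_maxP _ _ _ (i, j) xpredT (fun p : 'I_n * 'I_n => `|B p.1 p.2|) isT).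
move=> -[i0 j0] _ /= maxB; set m := `|B i0 j0| in maxB.
have BE : B = 1%:M - (C - 1%:M) *m B.
  by rewrite mulmxBl mul1mx mulmxV // opprB addrC subrK.
have key k l : `|B k l - (k == l)%:R| <= n%:R * delta * m.
  rewrite BE !mxE addrAC subrr add0r normrN.
  apply: le_trans (ler_norm_sum _ _ _) _.
  rewrite -mulrA mulr_natl -[X in _ *+ X](card_ord n) -sumr_const ler_sum // => k' _.
  rewrite normrM ler_pM ?normr_ge0 // ?(maxB (k', l)) //.
  by have := hC k k'; rewrite !mxE.
have m0 : 0 <= m by apply: normr_ge0.
have m2 : m <= 2.
  have := key i0 j0; have : `|(i0 == j0)%:R| <= 1 :> R.
    by case: eqP; rewrite ?normr1 ?normr0.
  have := ler_normB (B i0 j0 - (i0 == j0)%:R) (- (i0 == j0)%:R).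
  rewrite opprK subrK normrN -/m; nra.
apply: le_trans (key i j) _; apply: (le_trans _ e_eps); nra.
Qed.

End PositiveDefinite.

(** * Laplacians, pseudoinverses and variograms *)

Section Laplacian.
Variables (R : realType) (n : nat).
Local Notation V := 'I_n.+1.
Implicit Types A B X G Q S : 'M[R]_n.+1.

Local Notation one := (ones R n.+1).

(** The orthogonal projection onto the constant vectors. The matrices of interest vanish on that
    line, and adding the projection makes them invertible. *)
Definition meanproj : 'M[R]_n.+1 := n.+1%:R^-1 *: (one *m one^T).
Local Notation K := meanproj.

Lemma centeringE : centering R n.+1 = 1%:M - K. Proof. by []. Qed.

Lemma meanprojE i j : K i j = n.+1%:R^-1.
Proof. by rewrite !mxE big_ord1 !mxE !mulr1. Qed.

Lemma tr_meanproj : K^T = K.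
Proof. by apply/matrixP => i j; rewrite mxE !meanprojE. Qed.

Lemma meanproj_ones : K *m one = one.
Proof.
apply/matrixP => i j; rewrite mxE; under eq_bigr do rewrite meanprojE mxE mulr1.
by rewrite sumr_const card_ord !mxE -[_ *+ n.+1]mulr_natl mulfV ?pnatr_eq0.
Qed.

Lemma centering_ones : centering R n.+1 *m one = 0.
Proof. by rewrite centeringE mulmxBl mul1mx meanproj_ones subrr. Qed.

Lemma tr_centering : (centering R n.+1)^T = centering R n.+1.
Proof. by rewrite centeringE linearB /= trmx1 tr_meanproj. Qed.

Lemma meanproj_idem : K *m K = K.
Proof. by rewrite {2}/meanproj -scalemxAr mulmxA meanproj_ones. Qed.

Lemma mxtrace_meanproj : \tr K = 1.
Proof.
rewrite /mxtrace; under eq_bigr do rewrite meanprojE.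
by rewrite sumr_const card_ord -[_ *+ n.+1]mulr_natl mulfV ?pnatr_eq0.
Qed.

Lemma meanproj_kerr A : A *m one = 0 -> A *m K = 0.
Proof. by move=> A1; rewrite /meanproj -scalemxAr mulmxA A1 mul0mx scaler0. Qed.

Lemma meanproj_kerl A : A^T = A -> A *m one = 0 -> K *m A = 0.
Proof.
move=> As A1; apply: trmx_inj.
by rewrite trmx_mul tr_meanproj As meanproj_kerr // trmx0.
Qed.

Lemma meanproj_quad (x : 'cV[R]_n.+1) :
  (x^T *m K *m x) 0 0 = (\sum_i x i 0) ^+ 2 / n.+1%:R.
Proof.
have E : x^T *m one = (\sum_i x i 0)%:M.
  apply/matrixP => i j; rewrite !ord1 !mxE eqxx.
  by apply: eq_bigr => k _; rewrite !mxE mulr1.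
have E' : one^T *m x = (\sum_i x i 0)%:M.
  by rewrite -[LHS]trmxK trmx_mul trmxK E tr_scalar_mx.
rewrite /meanproj -scalemxAr -scalemxAl !mulmxA E -mulmxA E' -scalar_mxM.
by rewrite mxE mxE eqxx mulr1n mulrC expr2.
Qed.

(** * Moore-Penrose inverses *)

Lemma penrose_uniq A X Y : penrose A X -> penrose A Y -> X = Y.
Proof.
move=> [AXA XAX AXs XAs] [AYA YAY AYs YAs].
(* The product [A *m X *m (A *m Y)] equals [A *m Y]; transposing it swaps the symmetric factors and
   gives [A *m X]. *)
have EL : A *m X = A *m Y.
  have : (A *m X *m (A *m Y))^T = (A *m Y)^T by rewrite mulmxA AXA.
  by rewrite trmx_mul AXs AYs mulmxA AYA.
have ER : X *m A = Y *m A.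
  have : (Y *m A *m (X *m A))^T = (Y *m A)^T by rewrite -!mulmxA (mulmxA A) AXA.
  by rewrite trmx_mul XAs YAs -!mulmxA (mulmxA A) AYA.
by rewrite -XAX -mulmxA EL mulmxA ER YAY.
Qed.

Lemma mpinvP A X : penrose A X -> mpinv A = X.
Proof.
move=> AX; apply: (@penrose_uniq A) => //.
by apply: (@xgetPex _ 0 [set X | penrose A X]); exists X.
Qed.

Section Shift.
Variable A : 'M[R]_n.+1.
Hypotheses (As : A^T = A) (A1 : A *m one = 0) (Au : A + K \in unitmx).

Lemma invmx_shiftK : invmx (A + K) *m K = K.
Proof.
have {2}-> : K = (A + K) *m K by rewrite mulmxDl meanproj_kerr // add0r meanproj_idem.
by rewrite mulmxA mulVmx // mul1mx.
Qed.

Lemma tr_invmx_shift : (invmx (A + K))^T = invmx (A + K).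
Proof. by rewrite trmx_inv linearD /= As tr_meanproj. Qed.

Lemma invmx_Kshift : K *m invmx (A + K) = K.
Proof. by apply: trmx_inj; rewrite trmx_mul tr_invmx_shift tr_meanproj invmx_shiftK. Qed.

(* On the orthogonal complement of the ones vector, A + K is A; on the ones
   vector it is the identity. *)
Lemma mpinv_shift : mpinv A = invmx (A + K) - K.
Proof.
apply: mpinvP; set X := invmx _.
have AB : A *m (X - K) = 1%:M - K.
  rewrite mulmxBr meanproj_kerr // subr0.
  by apply/eqP; rewrite eq_sym subr_eq -[X in _ + X]invmx_Kshift -mulmxDl mulmxV.
have BA : (X - K) *m A = 1%:M - K.
  apply: trmx_inj; rewrite trmx_mul !linearB /= tr_invmx_shift trmx1 tr_meanproj.
  by rewrite As -mulmxBr AB.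
split; rewrite ?AB ?BA.
- by rewrite mulmxBl mul1mx meanproj_kerl ?subr0.
- by rewrite mulmxBl mul1mx mulmxBr invmx_Kshift meanproj_idem subrr subr0.
- by rewrite linearB /= trmx1 tr_meanproj.
- by rewrite linearB /= trmx1 tr_meanproj.
Qed.

End Shift.

(** * Variograms and covariance matrices *)

Lemma variogram_shift A (u : V -> R) :
  variogram (\matrix_(i, j) (A i j + u i + u j)) = variogram A.
Proof. by apply/matrixP => i j; rewrite !mxE; ring. Qed.

Lemma variogramB_meanproj A : variogram (A - K) = variogram A.
Proof.
rewrite -[RHS](variogram_shift _ (fun=> - n.+1%:R^-1 / 2)); congr variogram.
by apply/matrixP => i j; rewrite [LHS]mxE [(- K) _ _]mxE meanprojE mxE; field.
Qed.

(** The covariance matrix whose pseudoinverse is [hr_precision G]. *)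
Definition covariance_of G : 'M[R]_n.+1 :=
  centering R n.+1 *m (- 2^-1 *: G) *m centering R n.+1.

(** Centring changes [- 2^-1 *: G] only by terms depending on a single index, which the variogram
    cancels. *)
Lemma variogram_covariance_of G : sym0 G -> variogram (covariance_of G) = G.
Proof.
case=> Gs G0; rewrite /covariance_of; set B := - 2^-1 *: G.
have Bs : B^T = B by rewrite linearZ /= Gs.
pose c := n.+1%:R^-1 : R; pose b i := \sum_k B i k.
have BK i j : (B *m K) i j = c * b i.
  by rewrite mxE mulrC mulr_suml; apply: eq_bigr => k _; rewrite meanprojE.
have KB i j : (K *m B) i j = c * b j.
  by rewrite -[K *m B]trmxK trmx_mul Bs tr_meanproj mxE BK.
have KBK i j : (K *m B *m K) i j = c * \sum_k c * b k.
  rewrite mxE mulrC mulr_suml; apply: eq_bigr => k _.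
  by rewrite meanprojE KB.
rewrite (_ : _ *m _ = \matrix_(i, j)
    (B i j + ((c * \sum_k c * b k) / 2 - c * b i)
           + ((c * \sum_k c * b k) / 2 - c * b j))).
  rewrite variogram_shift; apply/matrixP => i j; rewrite !mxE !G0.
  by field.
apply/matrixP => i j.
have sub X Y : (X - Y) i j = X i j - Y i j by rewrite !mxE.
rewrite centeringE mulmxBl mul1mx mulmxBr mulmx1 mulmxBl !sub.
by rewrite BK KB KBK [RHS]mxE; field.
Qed.

Lemma tr_covariance_of G : G^T = G -> (covariance_of G)^T = covariance_of G.
Proof.
move=> Gs; rewrite /covariance_of !trmx_mul linearZ /= Gs tr_centering.
by rewrite mulmxA.
Qed.

Lemma covariance_of_ones G : covariance_of G *m one = 0.
Proof. by rewrite /covariance_of -mulmxA centering_ones mulmx0. Qed.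

(** A vector splits into its centred part, where the cone condition gives positivity, and its mean,
    which [K] detects. *)
Lemma posdef_covariance_of G : cnd_cone G -> posdef (covariance_of G + K).
Proof.
move=> [[Gs G0] Gneg]; split=> [|x x0].
  by rewrite linearD /= tr_covariance_of // tr_meanproj.
rewrite mulmxDr mulmxDl mxE meanproj_quad.
pose y := centering R n.+1 *m x.
have yE : x^T *m covariance_of G *m x = - 2^-1 *: (y^T *m G *m y).
  rewrite /y /covariance_of trmx_mul tr_centering -scalemxAr -scalemxAl.
  by rewrite -scalemxAr -scalemxAl !mulmxA.
have y1 : y^T *m one = 0.
  by rewrite /y trmx_mul tr_centering -mulmxA centering_ones mulmx0.
rewrite yE mxE; have [y0|y0] := eqVneq y 0; last first.
  rewrite ltr_pwDl //; last by rewrite divr_ge0 ?sqr_ge0.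
  by rewrite mulNr oppr_gt0 pmulr_rlt0 ?Gneg.
rewrite y0 mulmx0 mxE mulr0 add0r divr_gt0 // lt0r sqr_ge0 andbT sqrf_eq0.
apply: contra_neq x0 => sx0.
have xK : x = K *m x.
  by apply/eqP; rewrite -subr_eq0; move: y0; rewrite /y centeringE mulmxBl mul1mx => ->.
rewrite xK; apply/matrixP => i j; rewrite mxE ord1.
under eq_bigr do rewrite meanprojE.
by rewrite -mulr_sumr sx0 mulr0 mxE.
Qed.

(** * Weighted Laplacians and the spanning-tree sum *)

Lemma laplacian_ones Q : laplacian Q *m one = 0.
Proof.
apply/matrixP => i j; rewrite !mxE; under eq_bigr do rewrite !mxE mulr1.
rewrite (bigD1 i) //= eqxx [X in _ + X](eq_bigr (fun k => - Q i k)).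
  by rewrite sumrN subrr.
by move=> k ki; rewrite eq_sym (negbTE ki).
Qed.

Lemma tr_laplacian Q : Q^T = Q -> (laplacian Q)^T = laplacian Q.
Proof.
move=> Qs; apply/matrixP => i j; rewrite !mxE eq_sym; case: eqP => [->//|_].
by rewrite -[in LHS]Qs mxE.
Qed.

Lemma sum_delta (F : V -> R) i : \sum_j (i == j)%:R * F j = F i.
Proof.
rewrite (bigD1 i) //= eqxx mul1r big1 ?addr0 // => j ji.
by rewrite eq_sym (negbTE ji) mul0r.
Qed.

Lemma laplacianE Q i j : Q i i = 0 ->
  laplacian Q i j = (i == j)%:R * (\sum_k Q i k) - Q i j.
Proof.
move=> Q0; rewrite mxE; case: eqP => [<-|_]; last by rewrite mul0r sub0r.
by rewrite mul1r [in RHS](bigD1 i) //= Q0 add0r subr0.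
Qed.

Lemma sprodE A B : sym0 A -> sym0 B ->
  \sum_i \sum_j A i j * B i j = 2 * sprod A B.
Proof.
move=> [As A0] [Bs B0].
have E : \sum_(i : V) \sum_(j : V | (j < i)%N) A i j * B i j = sprod A B.
  rewrite (exchange_big_dep xpredT) //=; apply: eq_bigr => j _; apply: eq_bigr => i _.
  by rewrite -[in LHS]As -[in LHS]Bs !mxE.
rewrite mulr_natl mulr2n -{2}E /sprod -big_split /=; apply: eq_bigr => i _.
rewrite [LHS](bigID (fun j : V => (i < j)%N)) /=; congr (_ + _).
rewrite (bigD1 i) ?ltnn //= A0 mul0r add0r; apply: eq_bigl => j.
by rewrite -leqNgt ltn_neqAle andbC.
Qed.

Lemma laplacian_quad Q (x : 'cV[R]_n.+1) : sym0 Q ->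
  (x^T *m laplacian Q *m x) 0 0 =
  (\sum_i \sum_j Q i j * (x i 0 - x j 0) ^+ 2) / 2.
Proof.
move=> [Qs Q0].
have Qij i j : Q i j = Q j i by rewrite -[in LHS]Qs mxE.
have -> : (x^T *m laplacian Q *m x) 0 0 =
    \sum_i \sum_j Q i j * (x i 0 ^+ 2 - x i 0 * x j 0).
  rewrite -mulmxA mxE; apply: eq_bigr => i _; rewrite mxE mxE.
  under eq_bigr do rewrite laplacianE // mulrBl -mulrA.
  rewrite sumrB sum_delta mulr_suml -sumrB mulr_sumr; apply: eq_bigr => j _ /=; ring.
apply: (mulIf (_ : 2 != 0)); rewrite ?pnatr_eq0 // divfK ?pnatr_eq0 //.
rewrite mulr_natr mulr2n {2}exchange_big -big_split /=; apply: eq_bigr => i _.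
rewrite -big_split /=; apply: eq_bigr => j _; rewrite (Qij j i); ring.
Qed.

Lemma posdef_laplacian Q : U_plus Q -> posdef (laplacian Q + K).
Proof.
move=> [Q0 Qge conn]; split=> [|x x0].
  by rewrite linearD /= tr_laplacian ?tr_meanproj //; case: Q0.
rewrite mulmxDr mulmxDl mxE meanproj_quad laplacian_quad //.
have q0 i j : 0 <= Q i j * (x i 0 - x j 0) ^+ 2 by rewrite mulr_ge0 ?sqr_ge0.
have s0 : 0 <= \sum_i \sum_j Q i j * (x i 0 - x j 0) ^+ 2.
  by apply: sumr_ge0 => i _; apply: sumr_ge0.
have p0 : 0 <= (\sum_i x i 0) ^+ 2 / n.+1%:R by rewrite divr_ge0 ?sqr_ge0.
have s2 : 0 <= (\sum_i \sum_j Q i j * (x i 0 - x j 0) ^+ 2) / 2 by rewrite divr_ge0.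
rewrite lt0r addr_ge0 // andbT paddr_eq0 //.
rewrite !mulf_eq0 !invr_eq0 !pnatr_eq0 !orbF orbb; apply: contra x0.
case/andP => sE xE.
(* When both terms vanish, [x] agrees across every edge, hence is constant by connectedness, and its
   sum is 0. *)
have loc i j : Q i j != 0 -> x i 0 = x j 0.
  move=> Qij; apply/eqP; move: sE.
  rewrite psumr_eq0 => [/allP/(_ i)|k _]; last exact: sumr_ge0.
  rewrite mem_index_enum => /(_ isT); rewrite psumr_eq0 // => /allP/(_ j).
  by rewrite mem_index_enum => /(_ isT); rewrite mulf_eq0 (negbTE Qij) sqrf_eq0 subr_eq0.
have cst i : x i 0 = x 0 0.
  have /forallP/(_ i)/forallP/(_ 0)/connectP[p + ->] := conn.
  by elim: p i => //= j p IH i /andP[/loc -> /IH].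
move: xE; rewrite (eq_bigr (fun=> x 0 0)) // sumr_const card_ord mulrn_eq0 /= => /eqP z.
by apply/eqP/matrixP => i j; rewrite ord1 cst z mxE.
Qed.

Definition tree_sum Q : R :=
  \sum_(T : {set V * V} | spanning_tree T) \prod_(p in T) Q p.1 p.2.

(** Dyadic operations turn [L + K] into the Laplacian grounded at vertex 0; the row operations have
    determinant 1 and the column operation has determinant [n.+1]. *)
Lemma det_laplacian Q : sym0 Q -> \det (laplacian Q + K) = n.+1%:R * tree_sum Q.
Proof.
move=> [Qs Q0].
have Qij i j : Q i j = Q j i by rewrite -[in LHS]Qs mxE.
rewrite /tree_sum (sum_spanning_tree 0 Qij) -det_grounded_laplacian //.
set M := \matrix_(i, k) _; set L := laplacian Q.
pose u : 'cV[R]_n.+1 := delta_mx 0 0; pose v := one - u.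
have vu : v^T *m u = 0.
  rewrite -colE; apply/matrixP => i j; rewrite !ord1 !mxE.
  by rewrite !eqxx subrr.
have uv : u^T *m v = 0 by rewrite -[LHS]trmxK trmx_mul trmxK vu trmx0.
have v1 : v^T *m one = n%:R%:M.
  apply/matrixP => i j; rewrite !ord1 mxE.
  under eq_bigr do rewrite !mxE mulr1 andbT.
  rewrite sumrB sumr_const card_ord (bigD1 0) //= big1 => [|k /negbTE ->//].
  by rewrite addr0 -[n.+1]addn1 natrD addrK mxE eqxx.
have L1 : one^T *m L = 0.
  by apply: trmx_inj; rewrite trmx_mul trmxK tr_laplacian // laplacian_ones trmx0.
have ME : M = L + u *m (u^T - u^T *m L).
  have uE k : (u^T - u^T *m L) 0 k = (0 == k)%:R - L 0 k.
    rewrite trmx_delta -rowE [LHS]mxE [X in _ + X]mxE [X in _ - X]mxE [X in X - _]mxE.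
    by rewrite eqxx eq_sym.
  apply/matrixP => i k; rewrite mxE [RHS]mxE [(u *m _) _ _]mxE big_ord1 uE.
  rewrite [u i 0]mxE eqxx andbT -laplacianE //; case: eqP => [->|_].
    by rewrite mul1r addrC subrK.
  by rewrite mul0r addr0.
pose a : R := n.+1%:R^-1.
have Ka : K = a *: (one *m one^T) by [].
have oneE : one = u + v by rewrite addrC subrK.
have u1 : u^T *m one = 1%:M.
  apply/matrixP => i j; rewrite !ord1 trmx_delta -rowE !mxE.
  by rewrite eqxx.
(* Adding the other rows to row 0 clears that row of [L], whose columns sum to zero. *)
have P1 : (1%:M + u *m v^T) *m (L + K) =
    L - u *m (u^T *m L) + K + (a * n%:R) *: (u *m one^T).
  have vL : v^T *m L = - (u^T *m L) by rewrite linearB /= mulmxBl L1 sub0r.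
  have vK : v^T *m K = (a * n%:R) *: one^T.
    by rewrite Ka -scalemxAr mulmxA v1 mul_scalar_mx scalerA.
  rewrite mulmxDl mul1mx mulmxDr -!mulmxA vL vK mulmxN -scalemxAr.
  by rewrite addrACA addrA.
have an : a + a * n%:R = 1.
  by rewrite -[X in X + _]mulr1 -mulrDr addrC natr1 mulVf ?pnatr_eq0.
(* Row 0 is now [one^T]; subtracting [a] times it from the other rows removes [K] there. *)
have E : (1%:M - a *: (v *m u^T)) *m (1%:M + u *m v^T) *m (L + K) =
         M *m (1%:M + one *m v^T).
  rewrite -mulmxA P1 mulmxBl mul1mx -scalemxAl -mulmxA.
  have -> : u^T *m (L - u *m (u^T *m L) + K + (a * n%:R) *: (u *m one^T)) = one^T.
    have uu : u^T *m u = 1%:M.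
      by rewrite -[X in _ *m X](addrK v) -oneE mulmxBr u1 uv subr0.
    rewrite !mulmxDr mulmxN !mulmxA uu mul1mx subrr add0r Ka -!scalemxAr !mulmxA.
    by rewrite u1 uu mul1mx -scalerDl an scale1r.
  have M1 : M *m one = u.
    by rewrite ME mulmxDl laplacian_ones add0r -mulmxA mulmxBl u1 -mulmxA
      laplacian_ones mulmx0 subr0 mulmx1.
  rewrite mulmxDr mulmx1 (mulmxA M) M1 ME mulmxBr -!addrA; congr (_ + _).
  rewrite [RHS]addrCA; congr (_ + _).
  have uvT : u^T + v^T = one^T by rewrite oneE [RHS]linearD.
  have KE : K = a *: (u *m one^T) + a *: (v *m one^T).
    by rewrite -scalerDr -mulmxDl -oneE.
  by rewrite -mulmxDr uvT KE addrACA subrr addr0 -scalerDl an scale1r.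
have := congr1 determinant E; rewrite !det_mulmx !det_1_add_dyad vu v1.
have -> : 1%:M - a *: (v *m u^T) = 1%:M + (- a *: v) *m u^T.
  by rewrite -scalemxAl scaleNr.
rewrite det_1_add_dyad -scalemxAr uv scaler0 !mxE !addr0 !mul1r => ->.
by rewrite mulrC eqxx nat1r.
Qed.

(** Adding the sum with [i] and [j] exchanged turns [S i i - S i j] into a variogram entry. This
    makes the linear part of [ell] a trace. *)
Lemma mxtrace_mul_laplacian S Q : S^T = S -> sym0 Q ->
  \tr (S *m laplacian Q) = sprod (variogram S) Q.
Proof.
move=> Ss [Qs Q0].
have Sij i j : S i j = S j i by rewrite -[in LHS]Ss mxE.
have Qij i j : Q i j = Q j i by rewrite -[in LHS]Qs mxE.
have vs : sym0 (variogram S).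
  split=> [|i]; last by rewrite mxE; ring.
  by apply/matrixP => i j; rewrite !mxE (Sij i j); ring.
apply: (mulfI (_ : 2 != 0)); rewrite ?pnatr_eq0 // -sprodE //.
have -> : \tr (S *m laplacian Q) = \sum_i \sum_j Q i j * (S i i - S i j).
  apply: eq_bigr => i _; rewrite mxE.
  under eq_bigr do rewrite -(tr_laplacian Qs) mxE laplacianE // mulrBr mulrCA.
  rewrite sumrB sum_delta mulr_sumr -sumrB; apply: eq_bigr => j _ /=; ring.
rewrite mulr_natl mulr2n {2}exchange_big -big_split /=; apply: eq_bigr => i _.
rewrite -big_split /=; apply: eq_bigr => j _; rewrite mxE (Qij j i) (Sij j i); ring.
Qed.

End Laplacian.

Import numFieldNormedType.Exports.
Local Open Scope classical_set_scope.

(** * Existence of maximizers *)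

Section Existence.
Variables (R : realType) (n : nat).
Local Notation V := 'I_n.+1.
Implicit Types G Q : 'M[R]_n.+1.

Lemma ellE Q G : ell Q G = ln (tree_sum Q) - sprod G Q.
Proof. by []. Qed.

Lemma tree_sum_gt0 Q : U_plus Q -> 0 < tree_sum Q.
Proof.
move=> UQ; have [Qs _ _] := UQ.
have := posdef_det_gt0 (posdef_laplacian UQ).
by rewrite det_laplacian // pmulr_rgt0.
Qed.

(** A positive sum contains a tree of nonzero weights, which connects the support. Connectedness is
    thus recovered after a compactness argument from the positivity of [tree_sum]. *)
Lemma U_plus_tree_sum Q : sym0 Q -> (forall i j, 0 <= Q i j) ->
  0 < tree_sum Q -> U_plus Q.
Proof.
move=> Qs Q0 t0; split=> //.
have /hasP[T _ /andP[sT]] : has (fun T : {set V * V} => spanning_tree T &&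
    (0 < \prod_(p in T) Q p.1 p.2)) (index_enum _).
  by rewrite -psumr_neq0 ?gt_eqF // => T _; apply: prodr_ge0.
move=> /lt0r_neq0/prodf_neq0 Tn0.
have /forallP conn : connected_rel (adj T) by case/and3P: sT.
apply/forallP => i; apply/forallP => j.
have := forallP (conn i) j; apply: connect_sub => k l /orP[] kl; apply: connect1.
  exact: (Tn0 (k, l)).
by rewrite -(Qs.1) mxE; apply: (Tn0 (l, k)).
Qed.

(** Only the entries above the diagonal are read, so every row vector yields an element of [sym0]
    and the extreme value theorem applies on a box. *)
Definition mx_of_rV (v : 'rV[R]_(n.+1 * n.+1)) : 'M[R]_n.+1 :=
  \matrix_(i, j) (if (i < j)%N then v 0 (mxvec_index i j)
                  else if (j < i)%N then v 0 (mxvec_index j i) else 0).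

Lemma sym0_mx_of_rV v : sym0 (mx_of_rV v).
Proof.
split=> [|i]; last by rewrite mxE ltnn.
by apply/matrixP => i j; rewrite !mxE; case: ltngtP.
Qed.

Lemma mx_of_rVK Q : sym0 Q -> mx_of_rV (mxvec Q) = Q.
Proof.
move=> [Qs Q0]; apply/matrixP => i j; rewrite !mxE !mxvecE.
case: ltngtP => // [_|/val_inj ->]; last by rewrite Q0.
by rewrite -[in RHS]Qs mxE.
Qed.

Lemma continuous_mx_of_rV i j : continuous (fun v => mx_of_rV v i j).
Proof.
have -> : (fun v => mx_of_rV v i j) = (fun v : 'rV[R]_(n.+1 * n.+1) =>
    if (i < j)%N then v 0 (mxvec_index i j)
    else if (j < i)%N then v 0 (mxvec_index j i) else 0).
  by apply/funext => v; rewrite mxE.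
case: (i < j)%N; first exact: coord_continuous.
by case: (j < i)%N; [exact: coord_continuous | exact: cst_continuous].
Qed.

Lemma ell_maximizer_exists G Q0 (b : R) : U_plus Q0 ->
  (forall Q, U_plus Q -> ell Q0 G <= ell Q G -> forall i j, Q i j <= b) ->
  exists Q, ell_maximizer G Q.
Proof.
move=> UQ0 bnd; have b0 : 0 <= b.
  by have := bnd _ UQ0 (lexx _) 0 0; case: UQ0 => -[_ ->].
(* On [U_plus] this is the exponential of [ell]. It is continuous everywhere and, for nonnegative
   weights, vanishes where the support is disconnected, so a maximizer on the box has connected
   support. *)
pose f v := tree_sum (mx_of_rV v) * expR (- sprod G (mx_of_rV v)).
pose A := [set v : 'rV[R]_(n.+1 * n.+1) | forall k, `[0, b] (v ord0 k)].
have inA Q : U_plus Q -> ell Q0 G <= ell Q G -> A (mxvec Q).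
  move=> UQ le k; have [i j] := mxvec_indexP k.
  by rewrite mxvecE /= in_itv /= (bnd _ UQ le) andbT; case: UQ.
have fE Q : U_plus Q -> f (mxvec Q) = expR (ell Q G).
  move=> UQ; have t0 := tree_sum_gt0 UQ.
  by rewrite /f mx_of_rVK ?ellE ?expRD ?lnK //; case: UQ.
have ct : continuous (fun v => tree_sum (mx_of_rV v)).
  apply: continuous_big => [|T _]; first exact: add_continuous.
  apply: continuous_big => [|p _]; first exact: mul_continuous.
  exact: continuous_mx_of_rV.
have cs : continuous (fun v => sprod G (mx_of_rV v)).
  apply: continuous_big => [|i _]; first exact: add_continuous.
  apply: continuous_big => [|j _]; first exact: add_continuous.
  move=> v; apply: (@cvgM _ _ _ (nbhs_filter v) (fun=> G i j) (fun w => mx_of_rV w i j)).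
    exact: cvg_cst.
  exact: continuous_mx_of_rV.
have cf : continuous f.
  move=> v; apply: (@cvgM _ _ _ (nbhs_filter v) (fun w => tree_sum (mx_of_rV w))).
    exact: ct.
  apply: (cvg_comp _ expR); last exact: continuous_expR.
  by apply: cvgN; exact: cs.
have [|||c /set_mem cA cmax] := @EVT_max_rV R _ f A.
- by exists (mxvec Q0); apply: inA.
- by apply: (@rV_compact _ _ (fun=> `[0, b]%classic)) => k; exact: segment_compact.
- exact: continuous_subspaceT.
have c0 : forall i j, 0 <= mx_of_rV c i j.
  have c0 k : 0 <= c ord0 k by have := cA k; rewrite /= in_itv /= => /andP[].
  by move=> i j; rewrite mxE; do 2 case: ifP => _ //.
have fc : expR (ell Q0 G) <= f c.
  by rewrite -fE //; apply/cmax/mem_set/inA.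
have tc : 0 < tree_sum (mx_of_rV c).
  by have := lt_le_trans (expR_gt0 _) fc; rewrite pmulr_lgt0 ?expR_gt0.
have Uc := U_plus_tree_sum (sym0_mx_of_rV c) c0 tc.
have fcE : f c = expR (ell (mx_of_rV c) G) by rewrite /f ellE expRD lnK.
exists (mx_of_rV c); split=> // Q UQ; rewrite -ler_expR -fcE.
(* A competitor below the level of [Q0] may lie outside the box. *)
have [le|/ltW le] := lerP (ell Q0 G) (ell Q G).
  by rewrite -fE //; apply/cmax/mem_set/inA.
by apply: le_trans fc; rewrite ler_expR.
Qed.

End Existence.

(** * Continuity of the estimator at the true parameter *)

Section Consistency.
Variables (R : realType) (n : nat).
Local Notation V := 'I_n.+1.
Local Notation K := (meanproj R n).
Implicit Types G Q : 'M[R]_n.+1.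

(** On the difference of two unit vectors the quadratic form equals [- 2 * G i j]. *)
Lemma cnd_cone_gt0 G i j : cnd_cone G -> i != j -> 0 < G i j.
Proof.
move=> [[Gs G0] neg] ij; pose x : 'cV[R]_n.+1 := delta_mx i 0 - delta_mx j 0.
have x0 : x != 0.
  apply/eqP => /matrixP/(_ i 0)/eqP; rewrite !mxE !eqxx (negbTE ij) subr0.
  by rewrite oner_eq0.
have xT : x^T = delta_mx 0 i - delta_mx 0 j by rewrite linearB /= !trmx_delta.
have x1 : x^T *m ones R n.+1 = 0.
  rewrite xT mulmxBl -!rowE; apply/matrixP => a b.
  by rewrite !mxE subrr.
have := neg _ x0 x1; rewrite xT mulmxBr !mulmxBl -!rowE -!colE !mxE !G0.
have -> : G j i = G i j by rewrite -[in LHS]Gs mxE.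
lra.
Qed.

Lemma fin_lower_bound (I : finType) (P : pred I) (f : I -> R) :
  (forall i, P i -> 0 < f i) -> exists2 c, 0 < c & forall i, P i -> c <= f i.
Proof.
move=> f0; exists (\big[Num.min/1]_(i | P i) f i).
  by elim/big_ind: _ => // x y x0 y0; rewrite lt_min x0.
by move=> i Pi; rewrite (bigD1 i) //= ge_min lexx.
Qed.

Lemma mulmx_entry_le m p q (A : 'M[R]_(m, p)) (B : 'M[R]_(p, q)) (a b : R) :
  (forall i j, `|A i j| <= a) -> (forall i j, `|B i j| <= b) ->
  forall i j, `|(A *m B) i j| <= p%:R * (a * b).
Proof.
move=> Aa Bb i j; rewrite mxE; apply: le_trans (ler_norm_sum _ _ _) _.
rewrite mulr_natl -[X in _ *+ X](card_ord p) -sumr_const ler_sum // => k _.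
by rewrite normrM ler_pM.
Qed.

Lemma variogramB G Q : variogram (G - Q) = variogram G - variogram Q.
Proof. by apply/matrixP => i j; rewrite !mxE; ring. Qed.

Variable Gamma : 'M[R]_n.+1.
Hypotheses (cndG : cnd_cone Gamma) (emtp2G : EMTP2 Gamma).

Definition shifted_precision : 'M[R]_n.+1 := invmx (covariance_of Gamma + K).
Local Notation A0 := shifted_precision.

Let symG : sym0 Gamma. Proof. by case: cndG. Qed.

Lemma posdef_shifted_precision : posdef A0.
Proof. exact/posdef_invmx/posdef_covariance_of. Qed.

Let Su : covariance_of Gamma + K \in unitmx.
Proof. exact/posdef_unit/posdef_covariance_of. Qed.

Let Ss : (covariance_of Gamma)^T = covariance_of Gamma.
Proof. by apply: tr_covariance_of; case: symG. Qed.

Lemma hr_precisionE : hr_precision Gamma = A0 - K.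
Proof. by apply: mpinv_shift => //; apply: covariance_of_ones. Qed.

Definition true_weights : 'M[R]_n.+1 :=
  \matrix_(i, j) if i == j then 0 else - hr_precision Gamma i j.
Local Notation Q0 := true_weights.

Lemma sym0_true_weights : sym0 Q0.
Proof.
split=> [|i]; last by rewrite mxE eqxx.
apply/matrixP => i j; rewrite !mxE eq_sym; case: eqP => // _.
have [As _] := posdef_shifted_precision.
have E : (hr_precision Gamma)^T = hr_precision Gamma.
  by rewrite hr_precisionE linearB /= As tr_meanproj.
by rewrite -[in LHS]E mxE.
Qed.

(** Since [covariance_of Gamma + K] fixes the ones vector, the precision matrix annihilates it; zero
    row sums then determine the diagonal. *)
Lemma laplacian_true_weights : laplacian Q0 + K = A0.
Proof.
have -> : laplacian Q0 = hr_precision Gamma; last by rewrite hr_precisionE subrK.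
have T1 : hr_precision Gamma *m ones R n.+1 = 0.
  rewrite hr_precisionE mulmxBl meanproj_ones.
  apply/eqP; rewrite subr_eq0; apply/eqP.
  have {1}<- : (covariance_of Gamma + K) *m ones R n.+1 = ones R n.+1.
    by rewrite mulmxDl covariance_of_ones add0r meanproj_ones.
  by rewrite mulmxA mulVmx // mul1mx.
apply/matrixP => i j; rewrite mxE; case: eqP => [<-|/eqP ij]; last first.
  by rewrite mxE (negbTE ij) opprK.
have /matrixP/(_ i 0) := T1; rewrite !mxE (bigD1 i) //= mxE mulr1 => /eqP.
rewrite addr_eq0 => /eqP ->; rewrite -sumrN; apply: eq_bigr => k ki.
by rewrite !mxE eq_sym (negbTE ki) mulr1.
Qed.

Lemma U_plus_true_weights : U_plus Q0.
Proof.
apply: U_plus_tree_sum; first exact: sym0_true_weights.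
  (* Nonnegativity of the weights is the [EMTP2] condition. *)
  by move=> i j; rewrite mxE; case: eqP => // /eqP ij; rewrite oppr_ge0 emtp2G.
have := posdef_det_gt0 posdef_shifted_precision.
rewrite -laplacian_true_weights det_laplacian; first by rewrite pmulr_rgt0.
exact: sym0_true_weights.
Qed.

Variable T : 'M[R]_n.+1.
Hypotheses (Tu : T \in unitmx) (TE : T *m A0 *m T^T = 1%:M).

Lemma gram_diagonalizer : T^T *m T = covariance_of Gamma + K.
Proof.
rewrite -[RHS]invmxK -/A0.
have A0u : A0 \in unitmx by rewrite unitmx_inv.
have : T *m (A0 *m T^T) = 1%:M by rewrite mulmxA.
move/mulmx1C => E; rewrite -[LHS]mul1mx -(mulVmx A0u) -!mulmxA (mulmxA A0) E.
by rewrite mulmx1.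
Qed.

(** The matrix C(Q): the shifted Laplacian in coordinates where that of [true_weights] is the
    identity. *)
Definition relative_laplacian Q : 'M[R]_n.+1 := T *m (laplacian Q + K) *m T^T.

Lemma posdef_relative_laplacian Q : U_plus Q -> posdef (relative_laplacian Q).
Proof. by move=> UQ; apply: posdef_congr => //; apply: posdef_laplacian. Qed.

(** The cross terms vanish because [covariance_of Gamma] and the Laplacian annihilate the ones
    vector; the 1 is the trace of [K]. *)
Lemma mxtrace_relative_laplacian Q : U_plus Q ->
  \tr (relative_laplacian Q) = sprod Gamma Q + 1.
Proof.
move=> [Qs _ _]; have [Qt _] := Qs.
rewrite mxtrace_mulC mulmxA gram_diagonalizer mulmxDl !mulmxDr !mxtraceD.
rewrite (meanproj_kerr (covariance_of_ones _)).
rewrite (meanproj_kerl (tr_laplacian Qt) (laplacian_ones _)) meanproj_idem.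
rewrite mxtrace0 !addr0 add0r mxtrace_meanproj mxtrace_mul_laplacian //.
by rewrite variogram_covariance_of.
Qed.

Lemma sprod_true_weights : sprod Gamma Q0 = n%:R.
Proof.
have := mxtrace_relative_laplacian U_plus_true_weights.
rewrite /relative_laplacian laplacian_true_weights TE mxtrace1 -natr1.
by move/addIr.
Qed.

(** The trace supplies the linear term, and the determinant of C(Q) is a ratio of tree sums because
    [T] normalizes the true one to 1. *)
Lemma ell_gap Q : U_plus Q ->
  ell Q Gamma = ell Q0 Gamma - logdet_gap (relative_laplacian Q).
Proof.
move=> UQ; have t0 := tree_sum_gt0 UQ.
have t00 := tree_sum_gt0 U_plus_true_weights.
rewrite /logdet_gap mxtrace_relative_laplacian // !ellE sprod_true_weights.
have -> : \det (relative_laplacian Q) = tree_sum Q / tree_sum Q0.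
  have := congr1 determinant TE; rewrite det1 -laplacian_true_weights.
  rewrite /relative_laplacian !det_mulmx det_tr !det_laplacian //; last first.
  - exact: sym0_true_weights.
  - by case: UQ.
  move: (\det T) (tree_sum Q0) t00 => t q q0 E.
  have qE : q^-1 = t * n.+1%:R * t.
    by apply: (mulIf (lt0r_neq0 q0)); rewrite mulVf ?gt_eqF // -[LHS]E; ring.
  by rewrite qE; ring.
by rewrite ln_div // -natr1; ring.
Qed.

(** * Perturbation of the likelihood *)

Variable c : R.
Hypotheses (c0 : 0 < c) (cG : forall i j, i != j -> c <= Gamma i j).

(** All terms of the sum are nonnegative, so a bound on the trace of C(Q) confines the weights to a
    box. *)
Lemma sprod_entry_ge Q i j : U_plus Q -> c * Q i j <= sprod Gamma Q.
Proof.
move=> [[Qs Qd] Q0 _].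
have G0 k l : 0 <= Gamma k l.
  have [->|/cG] := eqVneq k l; first by case: symG => _ ->.
  exact/le_trans/ltW.
have up (k l : V) : (k < l)%N -> c * Q k l <= sprod Gamma Q.
  move=> kl; have kl' : k != l by rewrite -val_eqE ltn_eqF.
  rewrite /sprod (bigD1 k) //= (bigD1 l) //= -addrA ler_wpDr //.
    by apply: addr_ge0; do ?[apply: sumr_ge0 => ? _]; rewrite mulr_ge0.
  by rewrite ler_wpM2r ?cG.
case: (ltngtP i j) => [/up//|/up|/val_inj ->].
  by rewrite -{1}Qs mxE.
rewrite Qd mulr0; apply: sumr_ge0 => a _; apply: sumr_ge0 => b _.
by rewrite mulr_ge0.
Qed.

(** Off the diagonal [k * c <= k * Gamma i j], so the error is relative to [Gamma] and can be summed
    against [Q]. *)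
Lemma sprod_near G Q (k : R) : U_plus Q ->
  (forall i j, `|G i j - Gamma i j| <= k * c) ->
  `|sprod G Q - sprod Gamma Q| <= k * sprod Gamma Q.
Proof.
move=> [_ Q0 _] near.
have kc0 : 0 <= k * c := le_trans (normr_ge0 _) (near 0 0).
have k0 : 0 <= k by rewrite -(pmulr_lge0 _ c0).
rewrite /sprod -sumrB mulr_sumr; apply: le_trans (ler_norm_sum _ _ _) _.
apply: ler_sum => i _; rewrite -sumrB mulr_sumr.
apply: le_trans (ler_norm_sum _ _ _) _; apply: ler_sum => j ij.
rewrite -mulrBl normrM (ger0_norm (Q0 i j)) mulrA ler_wpM2r //.
apply: le_trans (near i j) _; rewrite ler_wpM2l // cG // -val_eqE.
by rewrite ltn_eqF.
Qed.

Lemma near_maximizer G Q (k : R) : k <= 4^-1 ->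
  (forall i j, `|G i j - Gamma i j| <= k * c) ->
  U_plus Q -> ell Q0 G <= ell Q G ->
  sprod Gamma Q <= 5 * n.+1%:R /\
  logdet_gap (relative_laplacian Q) <= 6 * n.+1%:R * k.
Proof.
move=> k4 near UQ.
have kc0 : 0 <= k * c := le_trans (normr_ge0 _) (near 0 0).
have k0 : 0 <= k by rewrite -(pmulr_lge0 _ c0).
have := sprod_near UQ near; have := sprod_near U_plus_true_weights near.
have := ell_gap UQ; have := logdet_gap_ge_trace (posdef_relative_laplacian UQ).
rewrite mxtrace_relative_laplacian // !ellE sprod_true_weights !ler_norml.
have -> : n.+1%:R = n%:R + 1 :> R by rewrite natr1.
have n0 : 0 <= n%:R :> R by [].
have : 0 <= sprod Gamma Q.
  by apply: le_trans (sprod_entry_ge 0 0 UQ); case: UQ => -[_ ->]; rewrite mulr0.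
move: n%:R n0 (sprod Gamma Q) (sprod G Q) (sprod G Q0) (logdet_gap _).
move=> N N0 s s' s0' g s0 g1 g2 /andP[h1 h2] /andP[h3 h4] le.
(* Comparing [ell] at [Q] and at the true weights leaves only the two perturbation errors [k * s]
   and [k * N]. *)
have gk : g <= k * (N + s) by lra.
have k4s : k * (N + s) <= 4^-1 * (N + s) by rewrite ler_wpM2r ?addr_ge0.
(* The lower bound [(s + 1) / 2 - (N + 1) <= g] grows faster in [s] than the upper bound of slope
   [4^-1]. *)
have s5 : s <= 5 * (N + 1) by lra.
have : k * (N + s) <= k * (6 * (N + 1)) by rewrite ler_wpM2l //; lra.
by split=> //; lra.
Qed.

Lemma estimate_exists G (k : R) : k <= 4^-1 ->
  (forall i j, `|G i j - Gamma i j| <= k * c) -> exists Q, ell_maximizer G Q.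
Proof.
move=> k4 near.
apply: (@ell_maximizer_exists _ _ _ Q0 (5 * n.+1%:R / c)).
  exact: U_plus_true_weights.
move=> Q UQ le i j; rewrite ler_pdivlMr // mulrC.
apply: le_trans (sprod_entry_ge i j UQ) _.
by have [] := near_maximizer k4 near UQ le.
Qed.

Lemma invmx_relative_laplacian Q : U_plus Q ->
  T^T *m invmx (relative_laplacian Q) *m T = invmx (laplacian Q + K).
Proof.
move=> UQ; have Lu := posdef_unit (posdef_laplacian UQ).
have Cu := posdef_unit (posdef_relative_laplacian UQ).
have E : (laplacian Q + K) *m (T^T *m invmx (relative_laplacian Q) *m T) = 1%:M.
  have : T *m ((laplacian Q + K) *m T^T *m invmx (relative_laplacian Q)) = 1%:M.
    by rewrite !mulmxA mulmxV.
  by move/mulmx1C; rewrite !mulmxA.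
by rewrite -[LHS]mul1mx -(mulVmx Lu) -[LHS]mulmxA E mulmx1.
Qed.

(** Both inverses are pulled back through [T], the true one from the identity; the summand [K] does
    not affect variograms. *)
Lemma variogram_estimate Q : U_plus Q ->
  variogram (mpinv (laplacian Q)) - Gamma =
  variogram (T^T *m (invmx (relative_laplacian Q) - 1%:M) *m T).
Proof.
move=> UQ; have [Qs _ _] := UQ.
rewrite mpinv_shift ?variogramB_meanproj; last 3 first.
- by apply: tr_laplacian; case: Qs.
- exact: laplacian_ones.
- exact: posdef_unit (posdef_laplacian UQ).
rewrite mulmxBr mulmxBl mulmx1 invmx_relative_laplacian // gram_diagonalizer.
rewrite variogramB; congr (_ - _).
by rewrite -variogramB_meanproj addrK variogram_covariance_of.
Qed.

End Consistency.

Lemma emtp2_estimate_continuous (R : realType) n (Gamma : 'M[R]_n.+1) (eps : R) :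
  cnd_cone Gamma -> EMTP2 Gamma -> 0 < eps ->
  exists2 delta, 0 < delta & forall G G' : 'M[R]_n.+1,
    (forall i j, `|G i j - Gamma i j| <= delta) -> emtp2_estimate G G' ->
    forall i j, `|G' i j - Gamma i j| <= eps.
Proof.
move=> cndG emtp2G eps0.
have [T Tu TE] := posdef_diagonalize (posdef_shifted_precision cndG).
have [c c0 cG] : exists2 c : R, 0 < c & forall i j, i != j -> c <= Gamma i j.
  have [p|c c0 cG] := @fin_lower_bound R _ (fun p => p.1 != p.2)
    (fun p : 'I_n.+1 * 'I_n.+1 => Gamma p.1 p.2); first exact: cnd_cone_gt0.
  by exists c => // i j ij; apply: (cG (i, j)).
pose m : R := \sum_i \sum_j `|T i j|.
have mT i j : `|T i j| <= m.
  rewrite /m (bigD1 i) //= (bigD1 j) //= -addrA lerDl addr_ge0 ?sumr_ge0 //.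
  by move=> k _; apply: sumr_ge0.
have m0 : 0 <= m by apply: le_trans (mT 0 0).
(* An entry of [T^T *m D *m T] with [D] bounded by [e] costs two sums of [n.+1] terms, and a
   variogram entry combines four such entries, counted with multiplicity. *)
pose b : R := 4 * (n.+1%:R * (n.+1%:R * m * m)).
have b0 : 0 <= b by rewrite !mulr_ge0.
have e0 : 0 < eps / (b + 1) by rewrite divr_gt0 // ltr_wpDl.
(* The tolerances are chosen backwards: for the inverse of C(Q), for C(Q), for the gap, and then for
   the perturbation [k]. *)
have [d1 d10 inv_near] := invmx_near n.+1 e0.
have [eta eta0 gap_near] := logdet_gap_near n.+1 d10.
pose k : R := Num.min 4^-1 (eta / (6 * n.+1%:R)).
have k0 : 0 < k by rewrite lt_min invr_gt0 ltr0n divr_gt0 // mulr_gt0.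
have k4 : k <= 4^-1 by rewrite ge_min lexx.
have keta : 6 * n.+1%:R * k <= eta.
  by rewrite mulrC -ler_pdivlMr ?mulr_gt0 // ge_min lexx orbT.
exists (k * c); first by rewrite mulr_gt0.
move=> G G' near est.
(* Existence of a maximizer near [Gamma] rules out the arbitrary values of the estimate. *)
have [Q [UQ maxQ] G'E] := est (estimate_exists cndG emtp2G Tu TE c0 cG k4 near).
have UQ0 := U_plus_true_weights cndG emtp2G.
have [_ gapQ] := near_maximizer cndG emtp2G Tu TE c0 cG k4 near UQ (maxQ _ UQ0).
set C := relative_laplacian T Q in gapQ.
have Cpd : posdef C by apply: posdef_relative_laplacian.
have C1 := gap_near C Cpd (le_trans gapQ keta).
have D1 : forall i j, `|(invmx C - 1%:M) i j| <= eps / (b + 1).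
  by move=> i j; have := inv_near C (posdef_unit Cpd) C1 i j; rewrite !mxE.
have mTt i j : `|T^T i j| <= m by rewrite mxE.
have D2 := mulmx_entry_le (mulmx_entry_le mTt D1) mT.
have := variogram_estimate cndG Tu TE UQ; rewrite -G'E -/C => /matrixP E i j.
have := E i j; rewrite [in X in X = _]mxE [in X in X = _]mxE => ->; rewrite mxE.
move: (D2 i i) (D2 j j) (D2 i j); move: (_ i i) (_ j j) (_ i j) => x y z.
set e := eps / (b + 1) => h1 h2 h3.
have : 4 * (n.+1%:R * (n.+1%:R * (m * e) * m)) <= eps.
  have -> : 4 * (n.+1%:R * (n.+1%:R * (m * e) * m)) = b * e by rewrite /b; ring.
  rewrite /e mulrA ler_pdivrMr ?ltr_wpDl // mulrC ler_wpM2l ?(ltW eps0) //.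
  by rewrite lerDl.
move: h1 h2 h3; rewrite !ler_norml => /andP[? ?] /andP[? ?] /andP[? ?] ?.
by apply/andP; split; lra.
Qed.

(** * Convergence in probability *)

Lemma maxdist_le (R : realType) d (A B : 'M[R]_d) (e : R) : 0 <= e ->
  (maxdist A B <= e) = [forall i, forall j, `|A i j - B i j| <= e].
Proof.
move=> e0; apply/idP/forallP => [le i|le].
  apply/forallP => j; apply: le_trans le.
  by rewrite /maxdist (bigD1 i) //= le_max (bigD1 j) //= le_max lexx.
apply: bigmax_le => // i _; apply: bigmax_le => // j _.
exact: (forallP (le i)).
Qed.

Theorem theorem5p7 (R : realType) (d : nat)
  (disp : measure_display) (Om : measurableType disp) (P : probability Om R)
  (Gamma : 'M[R]_d) (Gbar Ghat : nat -> Om -> 'M[R]_d) :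
  cnd_cone Gamma ->
  EMTP2 Gamma ->
  (forall n, random_matrix (Gbar n)) ->
  (forall n w, sym0 (Gbar n w)) ->
  cvg_in_prob P Gbar Gamma ->
  (forall n w, emtp2_estimate (Gbar n w) (Ghat n w)) ->
  cvg_in_prob P Ghat Gamma.
Proof.
move=> cndG emtp2G _ _ Gcvg est eps eps0.
have [delta delta0 near] : exists2 delta, 0 < delta & forall n w,
    maxdist (Gbar n w) Gamma <= delta -> maxdist (Ghat n w) Gamma <= eps.
  (* In dimension 0 there are no entries to compare; the continuity lemma covers positive
     dimensions. *)
  case: d Gamma Gbar Ghat cndG emtp2G est {Gcvg} => [|d] Gamma Gbar Ghat cndG emtp2G est.
    by exists 1 => // n w _; rewrite maxdist_le ?ltW //; apply/forallP => -[].
  have [delta delta0 cont] := emtp2_estimate_continuous cndG emtp2G eps0.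
  exists delta => // n w; rewrite !maxdist_le ?ltW // => /forallP le.
  apply/forallP => i; apply/forallP => j; apply: cont (est n w) i j => k l.
  exact: (forallP (le k)).
(* A large error of [Ghat] forces one of [Gbar], so the outer probabilities are compared by
   monotonicity. *)
apply: squeeze_cvge (cvg_cst _) (Gcvg _ delta0).
apply: nearW => n; rewrite mu_ext_ge0 //=; apply: le_mu_ext => w /=.
by rewrite !ltNge; apply: contra; apply: near.
Qed.
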